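(* Let $R$ be a bleached local ring. For any positive integer $n$, the following are equivalent: (1) $T_n(R)$ is quasipolar. (2) $T_n\big(R[[x]]\big)$ is quasipolar.
   Context: All rings are associative with identity, not necessarily commutative; $U(R)$ and $J(R)$ denote the group of units and the Jacobson radical of $R$. A ring $R$ is local if $R/J(R)$ is a division ring. $R[[x]]$ is the power series ring over $R$ (with $x$ a central indeterminate), and $T_n(S)$ is the ring of $n\times n$ upper triangular matrices over a ring $S$. For $a$ in a ring $R$: $comm(a)=\{x\in R: xa=ax\}$, $comm^2(a)=\{x\in R: xy=yx \text{ for all } y\in comm(a)\}$, and $R^{qnil}=\{a\in R: 1+ax\in U(R)\text{ for every }x\in comm(a)\}$. An element $a\in R$ is quasipolar if there is an idempotent $p=p^2\in R$ with $p\in comm^2(a)$, $a+p\in U(R)$ and $ap\in R^{qnil}$. A ring is quasipolar if each of its elements is quasipolar. For $a\in R$ let $l_a,r_a:R\to R$ be the additive group endomorphisms $l_a(r)=ar$, $r_a(r)=ra$; thus $(l_a-r_b)(r)=ar-rb$. A local ring $R$ is bleached if for all $a\in J(R)$ and $b\in U(R)$ the maps $l_b-r_a$ and $l_a-r_b$ are both surjective. *)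

(* Defs.v *)
From HB Require Import structures.
From mathcomp Require Import all_boot all_algebra ring_quotient.
From mathcomp Require Import boolp.

Set Implicit Arguments.
Unset Strict Implicit.
Unset Printing Implicit Defensive.

Import GRing.Theory.
Local Open Scope ring_scope.

(* U(R). [GRing.unit] is only available on [unitRingType]s, that is, on rings
   which already carry a chosen inverse function. *)
Definition invertible (R : pzRingType) (a : R) : Prop :=
  exists b : R, b * a = 1 /\ a * b = 1.

Definition division_ring (R : pzRingType) : Prop :=
  (1 : R) <> 0 /\ forall a : R, a <> 0 -> invertible a.

(* Left ideals of R are the submodules of the regular left module R^o. *)
Definition left_ideal (R : pzRingType) (I : {pred R}) : Prop :=
  GRing.submod_closed (I : {pred R^o}).

Definition maximal_left_ideal (R : pzRingType) (M : {pred R}) : Prop :=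
  [/\ left_ideal M, 1 \notin M
    & forall I : {pred R}, left_ideal I -> 1 \notin I ->
        {subset M <= I} -> {subset I <= M}].

Section JacobsonRadical.
Variable R : pzRingType.

Definition jacobson : {pred R} :=
  [pred a | `[< forall M : {pred R}, maximal_left_ideal M -> a \in M >]].

Lemma jacobsonP a :
  reflect (forall M : {pred R}, maximal_left_ideal M -> a \in M)
          (a \in jacobson).
Proof. exact: asboolP. Qed.

Fact jacobson_zmod_closed : zmod_closed jacobson.
Proof.
split=> [|a b /jacobsonP Ja /jacobsonP Jb]; apply/jacobsonP=> M maxM.
  by case: maxM => -[].
have [[_ lM] _ _] := maxM.
by rewrite addrC -mulN1r; apply: (lM (-1)); [apply: Jb | apply: Ja].
Qed.

HB.instance Definition _ :=
  GRing.isZmodClosed.Build R jacobson jacobson_zmod_closed.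

Lemma jacobsonMl a b : b \in jacobson -> a * b \in jacobson.
Proof.
move/jacobsonP=> Jb; apply/jacobsonP=> M maxM.
have [[M0 lM] _ _] := maxM.
by rewrite -[a * b]addr0; apply: (lM a) => //; apply: Jb.
Qed.

Lemma jacobsonMr a b : a \in jacobson -> a * b \in jacobson.
Proof.
move/jacobsonP=> Ja; apply/jacobsonP=> M maxM.
have [[M0 lM] M1 maxMP] := maxM.
have [Mb|nMb] := boolP (b \in M).
  by rewrite -[a * b]addr0; apply: (lM a).
pose N : {pred R} := [pred s | s * b \in M].
suff maxN : maximal_left_ideal N by exact: (Ja N).
split=> [||I [I0 lI] I1 sNI s Is].
- split=> [|c u v]; rewrite !inE ?mul0r // => Mu Mv.
  by rewrite mulrDl -mulrA; apply: (lM c).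
- by rewrite inE mul1r.
rewrite inE; apply: contraT => nMsb.
(* M + R s b = R, hence b = m + r s b with m in M *)
pose K : {pred R} := [pred x | `[< exists r, x - r * (s * b) \in M >]].
have lK : left_ideal K.
  split=> [|c u v]; first by apply/asboolP; exists 0; rewrite mul0r subr0.
  move=> /asboolP[ru Mu] /asboolP[rv Mv]; apply/asboolP.
  exists (c * ru + rv); rewrite mulrDl opprD addrACA -mulrA -mulrBr.
  exact: (lM c).
have sMK : {subset M <= K}.
  by move=> x Mx; apply/asboolP; exists 0; rewrite mul0r subr0.
have Ksb : s * b \in K by apply/asboolP; exists 1; rewrite mul1r subrr.
have [K1|nK1] := boolP (1 \in K); last first.
  by rewrite (maxMP K lK nK1 sMK _ Ksb) in nMsb.
have /asboolP[r Mr] : b \in K.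
  by rewrite -[b]addr0 -[b]mulr1; apply: (lK.2 b) => //; case: lK.
have : 1 - r * s \in I.
  by apply: sNI; rewrite inE mulrBl mul1r -mulrA.
move=> I1rs; case/negP: I1.
rewrite -[1](subrK (r * s)) addrC.
exact: (lI r).
Qed.

End JacobsonRadical.

Arguments jacobson : clear implicits.

(* The quotient ring R / J(R). The library's [Quotient.quot] supplies the
   quotient group, but its ring structure only for commutative rings. *)
Definition residue_ring (R : pzRingType) := Quotient.quot (jacobson R).

Section ResidueRing.
Variable R : pzRingType.
Local Open Scope quotient_scope.
Local Notation Q := (residue_ring R).

HB.instance Definition _ := GRing.Zmodule.on Q.

Let piE (x y : R) : (\pi_Q x = \pi_Q y) <-> x - y \in jacobson R.
Proof. by rewrite Quotient.idealrBE; split=> /eqP. Qed.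

Let pi_repr (x : R) : repr (\pi_Q x) - x \in jacobson R.
Proof. by apply/piE; rewrite reprK. Qed.

Definition residue_one : Q := \pi_Q 1.
Definition residue_mul (u v : Q) : Q := \pi_Q (repr u * repr v).

Lemma residue_mul_pi (x y : R) :
  residue_mul (\pi_Q x) (\pi_Q y) = \pi_Q (x * y).
Proof.
apply/piE; set x' := repr _; set y' := repr _.
have -> : x' * y' - x * y = (x' - x) * y' + x * (y' - y).
  by rewrite mulrBl mulrBr addrA subrK.
by apply: rpredD; [apply: jacobsonMr | apply: jacobsonMl]; apply: pi_repr.
Qed.

Lemma residue_add_pi (x y : R) : \pi_Q x + \pi_Q y = \pi_Q (x + y) :> Q.
Proof. by rewrite [RHS]Quotient.pi_add. Qed.

Fact residue_mulA : associative residue_mul.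
Proof.
move=> u v w; rewrite -[u]reprK -[v]reprK -[w]reprK.
rewrite (residue_mul_pi (repr v)) (residue_mul_pi (repr u) (repr v)).
by rewrite (residue_mul_pi (repr u)) (residue_mul_pi (_ * _)) mulrA.
Qed.

Fact residue_mul1l : left_id residue_one residue_mul.
Proof. by move=> u; rewrite -[u]reprK residue_mul_pi mul1r. Qed.

Fact residue_mul1r : right_id residue_one residue_mul.
Proof. by move=> u; rewrite -[u]reprK residue_mul_pi mulr1. Qed.

Fact residue_mulDl : left_distributive residue_mul +%R.
Proof.
move=> u v w; rewrite -[u]reprK -[v]reprK -[w]reprK.
rewrite residue_add_pi (residue_mul_pi (_ + _)) (residue_mul_pi (repr u)).
by rewrite (residue_mul_pi (repr v)) residue_add_pi mulrDl.
Qed.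

Fact residue_mulDr : right_distributive residue_mul +%R.
Proof.
move=> u v w; rewrite -[u]reprK -[v]reprK -[w]reprK.
rewrite residue_add_pi (residue_mul_pi _ (_ + _)).
rewrite (residue_mul_pi _ (repr v)) (residue_mul_pi _ (repr w)).
by rewrite residue_add_pi mulrDr.
Qed.

HB.instance Definition _ := GRing.Zmodule_isPzRing.Build Q
  residue_mulA residue_mul1l residue_mul1r residue_mulDl residue_mulDr.

End ResidueRing.

Definition local_ring (R : pzRingType) : Prop :=
  division_ring (residue_ring R).

Definition bleached (R : pzRingType) : Prop :=
  forall a b : R, a \in jacobson R -> invertible b ->
    (forall s : R, exists r : R, b * r - r * a = s) /\
    (forall s : R, exists r : R, a * r - r * b = s).

Definition comm2 (R : pzRingType) (a x : R) : Prop :=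
  forall y : R, GRing.comm y a -> GRing.comm x y.

Definition qnil (R : pzRingType) (a : R) : Prop :=
  forall x : R, GRing.comm x a -> invertible (1 + a * x).

Definition quasipolar (R : pzRingType) (a : R) : Prop :=
  exists p : R, [/\ p * p = p, comm2 a p, invertible (a + p) & qnil (a * p)].

Definition quasipolar_ring (R : pzRingType) : Prop :=
  forall a : R, quasipolar a.

(* R[[x]]: a series is its sequence of coefficients. *)
Definition powerseries (R : pzRingType) : Type := nat -> R.

Section PowerSeries.
Variable R : pzRingType.
Local Notation S := (powerseries R).
Implicit Types f g h : S.

HB.instance Definition _ := gen_eqMixin S.
HB.instance Definition _ := gen_choiceMixin S.

Definition ps_zero : S := fun=> 0.
Definition ps_opp f : S := fun n => - f n.
Definition ps_add f g : S := fun n => f n + g n.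
Definition ps_one : S := fun n => (n == 0%N)%:R.
Definition ps_mul f g : S := fun n => \sum_(i < n.+1) f i * g (n - i)%N.

Fact ps_addA : associative ps_add.
Proof. by move=> f g h; apply/funext=> n; apply: addrA. Qed.
Fact ps_addC : commutative ps_add.
Proof. by move=> f g; apply/funext=> n; apply: addrC. Qed.
Fact ps_add0 : left_id ps_zero ps_add.
Proof. by move=> f; apply/funext=> n; apply: add0r. Qed.
Fact ps_addN : left_inverse ps_zero ps_opp ps_add.
Proof. by move=> f; apply/funext=> n; apply: addNr. Qed.

HB.instance Definition _ :=
  GRing.isZmodule.Build S ps_addA ps_addC ps_add0 ps_addN.


Fact ps_mulA : associative ps_mul.
Proof.
move=> f g h; apply/funext=> n; rewrite /ps_mul.
transitivity (\sum_(i < n.+1) \sum_(j < n.+1 | (i + j <= n)%N)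
    f i * (g j * h (n - (i + j))%N)).
  apply: eq_bigr => i _; rewrite mulr_sumr.
  rewrite (big_ord_widen n.+1
    (fun j => f i * (g j * h (n - i - j)%N))); last by rewrite ltnS leq_subr.
  apply: eq_big => [j|j _]; last by rewrite subnDA.
  by rewrite ltnS leq_subRL // -ltnS.
transitivity (\sum_(k < n.+1) \sum_(i < n.+1 | (i <= k)%N)
    f i * (g (k - i)%N * h (n - k)%N)); last first.
  apply: eq_bigr => k _; rewrite mulr_suml.
  rewrite (big_ord_widen n.+1
    (fun i => f i * g (k - i)%N * h (n - k)%N)) //.
  by apply: eq_big => [i|i _]; rewrite ?mulrA.
rewrite [RHS](exchange_big_dep xpredT) //=; apply: eq_bigr => i _.
have le_in : (i <= n)%N by rewrite -ltnS.
rewrite -(big_mkord (fun j => i + j <= n)%N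
  (fun j => f i * (g j * h (n - (i + j))%N))).
rewrite -(big_mkord (fun k => i <= k)%N
  (fun k => f i * (g (k - i)%N * h (n - k)%N))).
rewrite [RHS](@big_cat_nat _ _ _ i) //=; last exact: leqW.
rewrite [X in _ = X + _]big_nat_cond [X in _ = X + _]big_pred0; last first.
  by move=> k; rewrite /= ltnNge; case: (leqP i k); rewrite ?andbF.
rewrite add0r [RHS](big_addn 0 n.+1 i) subSn //.
rewrite [LHS](@big_cat_nat _ _ _ (n - i).+1) //=; last by rewrite ltnS leq_subr.
rewrite [X in _ + X = _]big_nat_cond [X in _ + X = _]big_pred0; last first.
  move=> j; apply/negP=> /andP[/andP[lt_j _]].
  by rewrite -leq_subRL // leqNgt lt_j.
rewrite addr0 big_nat_cond [RHS]big_nat_cond.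
apply: eq_big => [j|j _]; last by rewrite addnK addnC.
rewrite leq_addl andbT; case: (ltnP j) => //= lt_j.
by rewrite -leq_subRL // -ltnS lt_j.
Qed.

Fact ps_mul1l : left_id ps_one ps_mul.
Proof.
move=> f; apply/funext=> n; rewrite /ps_mul big_ord_recl /= subn0 mul1r.
by rewrite big1 ?addr0 // => i _; rewrite mul0r.
Qed.

Fact ps_mul1r : right_id ps_one ps_mul.
Proof.
move=> f; apply/funext=> n; rewrite /ps_mul big_ord_recr /= subnn mulr1.
rewrite big1 ?add0r // => i _; rewrite /ps_one subn_eq0 leqNgt ltn_ord.
by rewrite mulr0.
Qed.

Fact ps_mulDl : left_distributive ps_mul ps_add.
Proof.
move=> f g h; apply/funext=> n; rewrite /ps_mul /ps_add -big_split.
by apply: eq_bigr => i _; apply: mulrDl.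
Qed.

Fact ps_mulDr : right_distributive ps_mul ps_add.
Proof.
move=> f g h; apply/funext=> n; rewrite /ps_mul /ps_add -big_split.
by apply: eq_bigr => i _; apply: mulrDr.
Qed.

HB.instance Definition _ := GRing.Zmodule_isPzRing.Build S
  ps_mulA ps_mul1l ps_mul1r ps_mulDl ps_mulDr.

End PowerSeries.

Section UpperTriangular.
Variables (S : pzRingType) (n : nat).

(* [is_trig_mx] is the library's lower triangularity. *)
Definition upper_trig_mx : {pred 'M[S]_n} := [pred A | is_trig_mx A^T].

Lemma upper_trig_mxP (A : 'M[S]_n) :
  reflect (forall i j : 'I_n, (j < i)%N -> A i j = 0) (A \in upper_trig_mx).
Proof.
apply: (iffP is_trig_mxP) => A0 i j ij; last by rewrite mxE A0.
by have := A0 j i ij; rewrite mxE.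
Qed.

Fact upper_trig_mx_subring_closed : subring_closed upper_trig_mx.
Proof.
split=> [|A B /upper_trig_mxP A0 /upper_trig_mxP B0
         |A B /upper_trig_mxP A0 /upper_trig_mxP B0];
  apply/upper_trig_mxP=> i j ij; rewrite mxE.
- by rewrite -val_eqE /= gtn_eqF.
- by rewrite mxE A0 // B0 // subr0.
rewrite big1 // => k _; have [ki|ik] := ltnP k i; first by rewrite A0 ?mul0r.
by rewrite B0 ?mulr0 // (leq_trans ij).
Qed.

HB.instance Definition _ :=
  GRing.isSubringClosed.Build 'M[S]_n upper_trig_mx
    upper_trig_mx_subring_closed.

(* T_n(S) *)
Record upper_trig :=
  UpperTrig { upper_trig_val :> 'M[S]_n; _ : upper_trig_val \in upper_trig_mx }.

HB.instance Definition _ := [isSub for upper_trig_val].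
HB.instance Definition _ := [Choice of upper_trig by <:].
HB.instance Definition _ :=
  GRing.SubChoice_isSubPzRing.Build _ _ upper_trig upper_trig_mx_subring_closed.

End UpperTriangular.

Arguments upper_trig S n : clear implicits.

(* Main.v *)
(* For a local ring S in which a r - r b = s and b r - r a = s are solvable in r
   for every nonunit a and unit b, and for n > 1, the ring T_n(S) is quasipolar
   if and only if these solutions are unique. Indeed, the spectral idempotent p
   of A must have p_ii = 1 or 0 according to whether A_ii is a nonunit or a unit.
   Solvability lets one fill in such a p commuting with A, one superdiagonal at
   a time, and uniqueness forces the corners p y (1 - p) and (1 - p) y p to
   vanish for every y commuting with A. Conversely, if a z = z b, then z E_ij
   commutes with a diagonal matrix having a and b at positions i and j, hence
   with its spectral idempotent, so z = 0. For n = 1 there is no condition.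
   Finally, a power series is a unit exactly when its constant term is, so that
   locality, solvability and uniqueness can all be tested coefficient by
   coefficient and hold for R[[x]] exactly when they hold for R. *)

Require Import Defs.
From mathcomp Require Import all_boot all_algebra.
From mathcomp Require Import boolp classical_sets.

Set Implicit Arguments.
Unset Strict Implicit.
Unset Printing Implicit Defensive.

Import GRing.Theory.
Local Open Scope ring_scope.

(** * Units and local rings *)

Section Invertible.
Variable S : pzRingType.
Implicit Types a b c : S.

Lemma invertible_lr a b c : b * a = 1 -> a * c = 1 -> invertible a.
Proof.
move=> ba ac; exists b; split=> //.
by rewrite -[b]mulr1 -ac [b * _]mulrA ba mul1r.
Qed.

Lemma invertible1 : invertible (1 : S).
Proof. by exists 1; rewrite mulr1. Qed.

Lemma invertibleN a : invertible (- a) -> invertible a.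
Proof.
by case=> b [ba ab]; exists (- b); rewrite mulNr -mulrN ba -mulrNN opprK.
Qed.

(** Otherwise the left ideal generated by 1 + a is proper, and Zorn's lemma gives a maximal left
    ideal containing 1 + a. It contains a as well, hence 1. *)
Lemma jacobson_left_inverse a :
  a \in jacobson S -> exists b, b * (1 + a) = 1.
Proof.
move=> /jacobsonP Ja; apply: contrapT => noinv.
(* The last clause lets the empty set, the union of the empty chain, in. *)
pose P (A : set S) := [/\ forall c u v, A u -> A v -> A (c * u + v), ~ A 1
  & (exists x, A x) -> A (1 + a)].
have [|M [[linM M1 ne_M] maxM]] := @Zorn_bigcup S P.
  move=> F FP Ftot; split.
  - move=> c u v [A FA Au] [B FB Bv].
    have [AB|BA] := Ftot A B FA FB.
      by exists B => //; have [lin _ _] := FP B FB; apply: lin => //; apply: AB.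
    by exists A => //; have [lin _ _] := FP A FA; apply: lin => //; apply: BA.
  - by move=> [A FA A1]; have [_ nA1 _] := FP A FA.
  - move=> [x [A FA Ax]]; exists A => //.
    by have [_ _ h] := FP A FA; apply: h; exists x.
(* If M misses 1 + a, its last clause makes it empty, and the left ideal generated by 1 + a is a
   strictly larger member of the family. *)
have Ma : M (1 + a).
  apply: contrapT => nMa.
  have nM x : ~ M x by move=> Mx; apply: nMa; apply: ne_M; exists x.
  apply: (maxM [set x | exists r, x = r * (1 + a)]%classic).
    split=> [x /nM //|sub]; apply: (nM (1 + a)); apply: sub.
    by exists 1; rewrite mul1r.
  split=> [c u v [r ->] [s ->]|[r r1]|_].
  - by exists (c * r + s); rewrite mulrDl mulrA.
  - by apply: noinv; exists r.
  - by exists 1; rewrite mul1r.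
have M0 : M 0 by rewrite -(addNr (1 + a)) -mulN1r; apply: linM.
have maxM' : maximal_left_ideal [pred x | `[< M x >]].
  split=> [||I [I0 lI] I1 sMI x Ix].
  - split=> [|c u v]; first exact/asboolP.
    by move=> /asboolP Mu /asboolP Mv; apply/asboolP; apply: linM.
  - by apply/asboolP.
  apply/asboolP; apply: contrapT => nMx.
  apply: (maxM [set y | y \in I]%classic).
    split=> [y My|/(_ x Ix) //].
    by apply: sMI; apply/asboolP.
  split=> [c u v Iu Iv||_]; first exact: (lI c).
  - by rewrite /= (negPf I1).
  - by apply: sMI; apply/asboolP.
have /asboolP {}Ja := Ja _ maxM'.
by apply: M1; have := linM (-1) _ _ Ja Ma; rewrite mulN1r addrCA addNr addr0.
Qed.

(** A left inverse b of 1 + a equals 1 - b a, so it has a left inverse too, which must be 1 + a. *)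
Lemma jacobson_invertible a : a \in jacobson S -> invertible (1 + a).
Proof.
move=> Ja; have [b b1] := jacobson_left_inverse Ja.
have Jba : - (b * a) \in jacobson S by rewrite rpredN jacobsonMl.
have [c] := jacobson_left_inverse Jba.
have -> : 1 - b * a = b by rewrite -b1 mulrDr mulr1 addrK.
move=> cb; suff cE : c = 1 + a by exists b; rewrite -{2}cE.
by rewrite -[LHS]mulr1 -[X in _ * X]b1 mulrA cb mul1r.
Qed.

End Invertible.

(* Equivalent to being local, but free of ideals, so that it passes to power
   series through their constant terms. *)
Definition unit_local (S : pzRingType) : Prop :=
  (1 : S) <> 0 /\ forall a : S, invertible a \/ invertible (1 - a).

Section LocalRing.
Variables (R : pzRingType) (locR : local_ring R).
Local Open Scope quotient_scope.
Local Notation Q := (residue_ring R).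

Lemma residue_eq (x y : R) : \pi_Q x = \pi_Q y <-> x - y \in jacobson R.
Proof. by rewrite Quotient.idealrBE; split=> /eqP. Qed.

Lemma residue_pi0 : \pi_Q 0 = 0 :> Q.
Proof. by apply: (addrI (\pi_Q 0)); rewrite residue_add_pi !addr0. Qed.

(** Outside the radical, lift the inverse of the residue to u: both u a and a u lie in 1 + J(R),
    hence are units, so a has a left and a right inverse. *)
Lemma local_nonunit_jacobson (a : R) : ~ invertible a -> a \in jacobson R.
Proof.
move=> nUa; apply: contrapT => nJa; apply: nUa.
have [|u [ua au]] := locR.2 (\pi_Q a).
  by rewrite -residue_pi0 => /residue_eq; rewrite subr0.
have {}ua : repr u * a - 1 \in jacobson R.
  by apply/residue_eq; rewrite -residue_mul_pi reprK.
have {}au : a * repr u - 1 \in jacobson R.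
  by apply/residue_eq; rewrite -residue_mul_pi reprK.
have [b [+ _]] := jacobson_invertible ua.
have [c [_]] := jacobson_invertible au.
rewrite ![1 + _]addrC !subrK -mulrA => ac; rewrite mulrA => ba.
exact: invertible_lr ba ac.
Qed.

Lemma local_ring_unit_local : unit_local R.
Proof.
split=> [r10|a].
  case: locR => + _; apply; rewrite -residue_pi0.
  by apply/residue_eq; rewrite r10 subrr; apply: rpred0.
have [?|/local_nonunit_jacobson Ja] := pselect (invertible a); first by left.
by right; apply: jacobson_invertible; rewrite rpredN.
Qed.

End LocalRing.

Section UnitLocal.
Variables (S : pzRingType) (locS : unit_local S).
Implicit Types a b e x : S.

Lemma unit_local_idem e : e * e = e -> e = 0 \/ e = 1.
Proof.
move=> ee; have [[b [be _]]|[b [be _]]] := locS.2 e.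
  by right; rewrite -be -{2}ee mulrA be mul1r.
by left; rewrite -[e]mul1r -be -mulrA mulrBl mul1r ee subrr mulr0.
Qed.

(** The idempotent b a is 0 or 1, and b a = 0 would give 1 = a (b a) b = 0. *)
Lemma unit_local_rinv a b : a * b = 1 -> invertible a.
Proof.
move=> ab; apply: (@invertible_lr _ _ b b) => //.
have [] : b * a = 0 \/ b * a = 1.
  by apply: unit_local_idem; rewrite mulrA -(mulrA b) ab mulr1.
  move=> ba; case: locS => + _; case.
  by rewrite -[LHS]mulr1 -{1}ab -ab mulrA -(mulrA a) ba mulr0 mul0r.
by [].
Qed.

Lemma nonunitMr a x : ~ invertible a -> ~ invertible (a * x).
Proof.
move=> nUa [y [_ axy]]; apply: nUa.
by apply: (@unit_local_rinv _ (x * y)); rewrite mulrA.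
Qed.

Lemma nonunit_invertible1D a : ~ invertible a -> invertible (1 + a).
Proof.
move=> nUa; have [/invertibleN //|] := locS.2 (- a).
by rewrite opprK.
Qed.

End UnitLocal.


(** The bleached condition with nonunits in place of the Jacobson radical, so that it can be tested
    on constant terms. *)
Definition nonunit_unit_surj (S : pzRingType) : Prop :=
  forall a b s : S, ~ invertible a -> invertible b ->
    (exists r, a * r - r * b = s) /\ (exists r, b * r - r * a = s).

Definition nonunit_unit_inj (S : pzRingType) : Prop :=
  forall a b z : S, ~ invertible a -> invertible b ->
    (a * z = z * b -> z = 0) /\ (b * z = z * a -> z = 0).

Lemma bleached_nonunit_unit_surj (R : pzRingType) :
  local_ring R -> bleached R -> nonunit_unit_surj R.
Proof.
move=> locR blR a b s /(local_nonunit_jacobson locR) Ja Ub.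
by have [h1 h2] := blR a b Ja Ub; split; [apply: h2 | apply: h1].
Qed.

Lemma course_of_values_rec (T : Type) (step : seq T -> T) :
  exists r : nat -> T, forall n, r n = step (mkseq r n).
Proof.
pose fix prefix n :=
  if n is m.+1 then rcons (prefix m) (step (prefix m)) else [::].
exists (fun n => step (prefix n)) => n; congr step.
by elim: n => //= n {1}->; rewrite mkseqS.
Qed.

(** * Power series *)

Section PowerSeriesRing.
Variable S : pzRingType.
Local Notation PS := (powerseries S).
Implicit Types f g r s z : PS.

Lemma ps_coef0M f g : (f * g) 0%N = f 0%N * g 0%N.
Proof. exact: big_ord1. Qed.

(** Isolates [r n]: in each degree the unknown coefficient meets the same operator, built from the
    constant terms, and the rest involves only earlier coefficients. *)
Lemma ps_coef_sylvester f g r n :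
  (f * r - r * g) n = (f 0%N * r n - r n * g 0%N)
    + \sum_(i < n) (f (n - i)%N * r i - r i * g (n - i)%N).
Proof.
rewrite sumrB addrACA -opprD; congr (_ - _); last first.
  by rewrite [LHS]big_ord_recr /= subnn addrC.
transitivity (\sum_(i < n.+1) f (n - i)%N * r i).
  rewrite [LHS](reindex_inj rev_ord_inj); apply: eq_bigr => i _ /=.
  by rewrite subSS subKn // -ltnS.
by rewrite big_ord_recr /= subnn addrC.
Qed.

Lemma ps_sylvester_surj f g :
  (forall c : S, exists d : S, f 0%N * d - d * g 0%N = c) ->
  forall s : PS, exists r : PS, f * r - r * g = s.
Proof.
move=> /choice[phi phiP] s.
(* In degree n the list [h] holds r 0, ..., r (n - 1), whose contribution is subtracted from s n
   before solving. *)
have [r rE] := course_of_values_rec (fun h : seq S => phi (s (size h) -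
  \sum_(i < size h) (f (size h - i)%N * h`_i - h`_i * g (size h - i)%N))).
exists r; apply/funext => n; rewrite ps_coef_sylvester {1 2}rE phiP size_mkseq.
rewrite -addrA [X in _ + X](_ : _ = 0) ?addr0 // addrC; apply/eqP.
by rewrite subr_eq0; apply/eqP/eq_bigr => i _; rewrite nth_mkseq.
Qed.

Lemma ps_sylvester_inj f g :
  (forall c : S, f 0%N * c = c * g 0%N -> c = 0) ->
  forall z, f * z = z * g -> z = 0.
Proof.
move=> inj z fz; apply/funext; elim/ltn_ind => n IHn; apply: inj.
have := ps_coef_sylvester f g z n.
rewrite fz subrr big1 => [|i _]; last by rewrite IHn // mulr0 mul0r subr0.
by rewrite addr0 => /esym/eqP; rewrite subr_eq0 => /eqP.
Qed.

(** One-sided inverses solve f r - r 0 = 1 and 0 r - r f = -1, which reduce to the constant term. *)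
Lemma ps_invertible f : invertible f <-> invertible (f 0%N).
Proof.
split=> [[g [gf fg]]|[c [cf fc]]].
  by exists (g 0%N); rewrite -!ps_coef0M gf fg.
have [|r] := @ps_sylvester_surj f 0 _ 1.
  by move=> s; exists (c * s); rewrite mulr0 subr0 mulrA fc mul1r.
have [|l] := @ps_sylvester_surj 0 f _ (- 1).
  by move=> s; exists (- s * c); rewrite mul0r sub0r -mulrA cf mulr1 opprK.
rewrite mul0r sub0r => /oppr_inj lf; rewrite mulr0 subr0 => fr.
exact: invertible_lr lf fr.
Qed.

Lemma ps_unit_local : unit_local S -> unit_local PS.
Proof.
case=> S1 locS; split=> [/(congr1 (fun f : PS => f 0%N)) //|f].
by have [U|U] := locS (f 0%N); [left|right]; apply/ps_invertible.
Qed.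

Lemma ps_nonunit_unit_surj : nonunit_unit_surj S -> nonunit_unit_surj PS.
Proof.
move=> sur f g s nUf /ps_invertible Ug.
have {}nUf : ~ invertible (f 0%N) by move/ps_invertible.
by split; apply: ps_sylvester_surj => c; have [] := sur _ _ c nUf Ug.
Qed.

Definition ps_const (c : S) : PS := fun n => c *+ (n == 0%N).

Lemma ps_constM c d : ps_const (c * d) = ps_const c * ps_const d.
Proof.
apply/funext => n; rewrite [RHS]big_ord_recl /= subn0 big1 => [|i _].
  by rewrite addr0 /ps_const mulrnAr.
by rewrite [ps_const c _]mulr0n mul0r.
Qed.

Lemma ps_nonunit_unit_inj : nonunit_unit_inj S <-> nonunit_unit_inj PS.
Proof.
split=> inj a b z nUa Ub.
  move/ps_invertible in Ub.
  have {}nUa : ~ invertible (a 0%N) by move/ps_invertible.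
  by split; apply: ps_sylvester_inj => c; have [] := inj _ _ c nUa Ub.
have [||h1 h2] := inj (ps_const a) (ps_const b) (ps_const z).
- by move/ps_invertible.
- by apply/ps_invertible.
have const0 : ps_const z = 0 -> z = 0 by move/(congr1 (fun f : PS => f 0%N)).
by split=> e; apply: const0; [apply: h1|apply: h2]; rewrite -!ps_constM e.
Qed.

End PowerSeriesRing.

(** * Triangular matrices *)

Section TriangularRing.
Variables (S : pzRingType) (n : nat).
Local Notation T := (upper_trig S n).
Implicit Types (A B p y z : T) (i j k : 'I_n).

Lemma trig_eqP A B : (forall i j, A i j = B i j) -> A = B.
Proof. by move=> AB; apply/val_inj/matrixP. Qed.

Lemma trig_low A i j : (j < i)%N -> A i j = 0.
Proof. by case: A => M /= /upper_trig_mxP; apply. Qed.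

Lemma trig_coef0 i j : (0 : T) i j = 0. Proof. exact: mxE. Qed.

Lemma trig_coef1 i j : (1 : T) i j = (i == j)%:R. Proof. exact: mxE. Qed.

Lemma trig_coefD A B i j : (A + B) i j = A i j + B i j.
Proof. exact: mxE. Qed.

Lemma trig_coefN A i j : (- A) i j = - A i j.
Proof. exact: mxE. Qed.

Lemma trig_coefM A B i j : (A * B) i j = \sum_k A i k * B k j.
Proof. exact: mxE. Qed.

Definition trig_coefE := (trig_coefD, trig_coefN, trig_coef0, trig_coef1).

(** A decreasing multiplicative filtration of T_n(S) by two-sided ideals, starting at the whole ring
    and reaching 0 at d = n. *)
Definition band (d : nat) A := forall i j, (j < i + d)%N -> A i j = 0.

Lemma band0 A : band 0 A.
Proof. by move=> i j; rewrite addn0; apply: trig_low. Qed.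

Lemma bandD d A B : band d A -> band d B -> band d (A + B).
Proof. by move=> bA bB i j ij; rewrite trig_coefD bA // bB // addr0. Qed.

Lemma bandN d A : band d A -> band d (- A).
Proof. by move=> bA i j ij; rewrite trig_coefN bA // oppr0. Qed.

Lemma bandM d e A B : band d A -> band e B -> band (d + e) (A * B).
Proof.
move=> bA bB i j ij; rewrite trig_coefM big1 // => k _.
have [ki|ik] := ltnP k (i + d); first by rewrite bA ?mul0r.
by rewrite bB ?mulr0 // (leq_trans ij) // addnA leq_add2r.
Qed.

Lemma bandMr d A B : band d A -> band d (A * B).
Proof. by move=> bA; rewrite -[d]addn0; apply: bandM (@band0 B). Qed.

Lemma bandMl d A B : band d B -> band d (A * B).
Proof. by move=> bB; rewrite -[d]add0n; apply: bandM (@band0 A) _. Qed.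

Lemma band_eq0 d A : (n <= d)%N -> band d A -> A = 0.
Proof.
move=> nd bA; apply: trig_eqP => i j; rewrite trig_coef0 bA //.
by rewrite (leq_trans (ltn_ord j)) // (leq_trans nd) // leq_addl.
Qed.

Lemma band_step d A :
  band d A -> (forall i j, j = (i + d)%N :> nat -> A i j = 0) -> band d.+1 A.
Proof.
move=> bA A0 i j; rewrite addnS ltnS leq_eqVlt => /orP[/eqP|]; first exact: A0.
exact: bA.
Qed.

Lemma bandX A d : band 1 A -> band d (A ^+ d).
Proof.
move=> bA; elim: d => [|d IHd]; first exact: band0.
by rewrite exprS; apply: (@bandM 1).
Qed.

(** In the sum over k, the band forces k >= i + d >= j and triangularity of B forces k <= j. So the
    leading superdiagonal sees only the diagonal of B. *)
Lemma band_coefMr d A B i j :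
  band d A -> (j <= i + d)%N -> (A * B) i j = A i j * B j j.
Proof.
move=> bA ij; rewrite trig_coefM (bigD1 j) //= big1 ?addr0 // => k kj.
have [ki|ik] := ltnP k (i + d); first by rewrite bA ?mul0r.
by rewrite (@trig_low B) ?mulr0 // ltn_neqAle eq_sym kj (leq_trans ij).
Qed.

Lemma band_coefMl d A B i j :
  band d B -> (j <= i + d)%N -> (A * B) i j = A i i * B i j.
Proof.
move=> bB ij; rewrite trig_coefM (bigD1 i) //= big1 ?addr0 // => k ki.
have [lt_ki|ik] := ltnP k i; first by rewrite trig_low ?mul0r.
rewrite bB ?mulr0 // (leq_ltn_trans ij) // ltn_add2r ltn_neqAle ik andbT.
by rewrite eq_sym.
Qed.

Lemma trig_coefM_diag A B i : (A * B) i i = A i i * B i i.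
Proof. by rewrite (@band_coefMr 0) ?addn0 //; apply: band0. Qed.

Lemma trig_diag_subproof (d : 'I_n -> S) :
  \matrix_(i, j) (d i *+ (i == j)) \in @upper_trig_mx S n.
Proof.
by apply/upper_trig_mxP => i j ij; rewrite mxE -val_eqE gtn_eqF.
Qed.

Definition trig_diag (d : 'I_n -> S) : T := UpperTrig (trig_diag_subproof d).

Lemma trig_diagE d i j : trig_diag d i j = d i *+ (i == j).
Proof. exact: mxE. Qed.

Lemma trig_diagMl d A i j : (trig_diag d * A) i j = d i * A i j.
Proof.
rewrite trig_coefM (bigD1 i) //= trig_diagE eqxx big1 ?addr0 // => k ki.
by rewrite trig_diagE eq_sym (negPf ki) mul0r.
Qed.

Lemma trig_diagMr d A i j : (A * trig_diag d) i j = A i j * d j.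
Proof.
rewrite trig_coefM (bigD1 j) //= trig_diagE eqxx big1 ?addr0 // => k kj.
by rewrite trig_diagE (negPf kj) mulr0.
Qed.

Lemma trig_delta_subproof i j (z : S) : (i <= j)%N ->
  \matrix_(k, l) (z *+ ((k == i) && (l == j))) \in @upper_trig_mx S n.
Proof.
move=> ij; apply/upper_trig_mxP => k l lk; rewrite mxE.
case: eqP lk => // ->; case: eqP => // ->.
by rewrite ltnNge ij.
Qed.

Definition trig_delta i j (ij : (i <= j)%N) (z : S) : T :=
  UpperTrig (trig_delta_subproof z ij).

Lemma trig_deltaE i j (ij : (i <= j)%N) (z : S) (k l : 'I_n) :
  trig_delta ij z k l = z *+ ((k == i) && (l == j)).
Proof. exact: mxE. Qed.

(** A is nilpotent, so the geometric series is finite. *)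
Lemma invertible_1B_band1 A : band 1 A -> invertible (1 - A).
Proof.
move=> bA; have An0 : A ^+ n = 0 by apply: (@band_eq0 n) => //; apply: bandX.
have AG : (1 - A) * \sum_(i < n) A ^+ i = 1.
  by apply: oppr_inj; rewrite -mulNr opprB -subrX1 An0 sub0r.
exists (\sum_(i < n) A ^+ i); split=> //; rewrite -[RHS]AG.
apply/esym/commr_sum => i _; apply: commrX; apply/commr_sym.
by apply: commrB; [apply: commr1|].
Qed.

(** Scaling A on either side by the inverses of its diagonal entries puts ones on the diagonal; the
    two resulting units yield a left and a right inverse. *)
Lemma invertible_trigP A : invertible A <-> forall i, invertible (A i i).
Proof.
split=> [[B [BA AB]] i|/choice[d dP]].
  by exists (B i i); rewrite -!trig_coefM_diag BA AB trig_coef1 eqxx.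
have unitr1 B : (forall i, B i i = 1) -> invertible B.
  move=> B1; rewrite -[B](subKr 1); apply: invertible_1B_band1.
  apply: band_step => [|i j ij]; first exact: band0.
  have -> : j = i by apply: val_inj; rewrite /= ij addn0.
  by rewrite !trig_coefE eqxx B1 subrr.
have [|L [LA _]] := unitr1 (trig_diag d * A).
  by move=> i; rewrite trig_diagMl; have [] := dP i.
have [|M [_ AM]] := unitr1 (A * trig_diag d).
  by move=> i; rewrite trig_diagMr; have [] := dP i.
apply: (@invertible_lr _ _ (L * trig_diag d) (trig_diag d * M)).
  by rewrite -mulrA.
by rewrite mulrA.
Qed.

(* [p] is corrected one superdiagonal at a time. On a given superdiagonal,
   where [e i = e j] the entry of [p] is forced by [p * p = p], and the
   commutator [C = p * A - A * p] then vanishes by [p * C + C * p = C]; where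
   [e i <> e j] the defect of [p * p = p] already vanishes, as it commutes
   with [p], and the entry of [p] is found from the Sylvester equation. *)
Lemma exists_commuting_idempotent A (e : 'I_n -> S) :
  (forall i, e i = 0 \/ e i = 1) ->
  (forall i j, e i <> e j ->
     forall s : S, exists r : S, A i i * r - r * A j j = s) ->
  exists p, [/\ p * p = p, p * A = A * p & forall i, p i i = e i].
Proof.
move=> e01 sur.
suff /(_ n)[p [pe bE bC]] : forall d, exists p, [/\ forall i, p i i = e i,
    band d.+1 (p * p - p) & band d.+1 (p * A - A * p)].
  by exists p; split=> //; apply/eqP; rewrite -subr_eq0; apply/eqP;
    apply: (@band_eq0 n.+1).
elim=> [|d [p [pe bE bC]]].
  exists (trig_diag e); split=> [i|i j|i j]; first by rewrite trig_diagE eqxx.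
    rewrite addn1 ltnS leq_eqVlt => /orP[/eqP/val_inj->|ji];
      last exact: trig_low.
    rewrite !trig_coefE trig_diagMl trig_diagE eqxx mulr1n.
    by case: (e01 i) => ->; rewrite ?mulr1 ?mulr0 subrr.
  rewrite addn1 ltnS leq_eqVlt => /orP[/eqP/val_inj->|ji];
      last exact: trig_low.
  rewrite !trig_coefE trig_diagMl trig_diagMr.
  by case: (e01 i) => ->; rewrite ?mulr1 ?mul1r ?mulr0 ?mul0r subrr.
have [E E_def] : {E : T | E = p * p - p} by exists (p * p - p).
have [C C_def] : {C : T | C = p * A - A * p} by exists (p * A - A * p).
rewrite -E_def in bE; rewrite -C_def in bC.
have pE : p * E = E * p by rewrite E_def mulrBr mulrBl mulrA.
(* Entries of the correction [t] on superdiagonal d + 1: the first equation cancels [E] there, the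
   second cancels [C] where the diagonal values differ. *)
have /choice[t0 t0P] : forall ij : 'I_n * 'I_n, exists t : S,
    ij.2 = (ij.1 + d.+1)%N :> nat ->
    E ij.1 ij.2 + (e ij.1 * t + t * e ij.2 - t) = 0 /\
    (e ij.1 <> e ij.2 ->
       C ij.1 ij.2 + (t * A ij.2 ij.2 - A ij.1 ij.1 * t) = 0).
  move=> [i j] /=.
  have [eij|neij] := pselect (e i = e j).
    have [e0|e1] := e01 i.
      exists (E i j) => _; split=> //; rewrite -eij e0.
      by rewrite mul0r mulr0 !add0r subrr.
    exists (- E i j) => _; split=> //; rewrite -eij e1.
    by rewrite mul1r mulr1 opprK addrNK subrr.
  have [r rE] := sur i j neij (C i j); exists r => jE.
  split; last by move=> _; rewrite -[X in _ + X]opprB rE subrr.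
  have ij : (j <= i + d.+1)%N by rewrite jE.
  (* This reads e_i E_ij = E_ij e_j with {e_i, e_j} = {0, 1}, so E_ij = 0, while e_i r + r e_j = r
     for every r. *)
  have := congr1 (fun B : T => B i j) pE.
  rewrite (band_coefMl _ bE ij) (band_coefMr _ bE ij) !pe.
  case: (e01 i) (e01 j) neij => -> [] -> // _.
    by rewrite mul0r mulr1 => <-; rewrite mul0r mulr1 !add0r subrr.
  by rewrite mul1r mulr0 => ->; rewrite mul1r mulr0 addr0 add0r subrr.
have tU : \matrix_(i, j) (t0 (i, j) *+ (j == (i + d.+1)%N :> nat))
    \in @upper_trig_mx S n.
  apply/upper_trig_mxP => i j ij; rewrite mxE ltn_eqF //.
  by rewrite (leq_trans ij) // leq_addr.
pose t : T := UpperTrig tU.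
have tE i j : t i j = t0 (i, j) *+ (j == (i + d.+1)%N :> nat) by exact: mxE.
have bt : band d.+1 t by move=> i j ij; rewrite tE ltn_eqF.
have p'e i : (p + t) i i = e i.
  by rewrite trig_coefD pe bt ?addr0 // addnS ltnS leq_addr.
have E'E : (p + t) * (p + t) - (p + t) = E + (p * t + t * p - t) + t * t.
  by rewrite E_def [X in _ = X + _]addrACA [RHS]addrAC
    mulrDl !mulrDr opprD !addrA.
have C'E : (p + t) * A - A * (p + t) = C + (t * A - A * t).
  by rewrite C_def mulrDl mulrDr opprD addrACA.
(* The quadratic term starts at superdiagonal 2d + 2 >= d + 2, so only the linear part of the change
   matters. *)
have btt : band d.+2 (t * t).
  have : band (d.+1 + d.+1) (t * t) by apply: bandM.
  move=> h i j ij; apply: h; apply: leq_trans ij _.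
  by rewrite leq_add2l addSn addnS ltnS ltnS leq_addr.
exists (p + t).
have bE' : band d.+2 ((p + t) * (p + t) - (p + t)).
  rewrite E'E; apply: bandD btt; apply: band_step => [|i j jE].
    exact: bandD bE (bandD (bandD (bandMl p bt) (bandMr p bt)) (bandN bt)).
  have ij : (j <= i + d.+1)%N by rewrite jE.
  rewrite !trig_coefD !trig_coefN
    (band_coefMl _ bt ij) (band_coefMr _ bt ij) !pe.
  by rewrite tE jE eqxx; have [] := t0P (i, j) jE.
split=> //.
set p' := p + t in p'e bE' C'E *.
have bC' : band d.+1 (p' * A - A * p').
  by rewrite C'E; exact: bandD bC (bandD (bandMr A bt) (bandN (bandMl A bt))).
apply: band_step => // i j jE.
have ij : (j <= i + d.+1)%N by rewrite jE.
have [eij|neij] := pselect (e i = e j); last first.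
  rewrite C'E !trig_coefD !trig_coefN
    (band_coefMl _ bt ij) (band_coefMr _ bt ij).
  by rewrite tE jE eqxx; have [_ ->] := t0P (i, j) jE.
have [C' C'_def] : {C' : T | C' = p' * A - A * p'} by exists (p' * A - A * p').
rewrite -C'_def in bC' *.
(* By [bE'] the right side vanishes at (i, j), and the left side is there (2 e_i - 1) C'_ij, that
   is, C'_ij up to sign. *)
have : p' * C' + C' * p' - C' = (p' * p' - p') * A - A * (p' * p' - p').
  rewrite C'_def mulrBl !mulrBr !mulrBl !mulrA addrA subrK !opprB.
  by rewrite addrACA [RHS]addrACA; congr (_ + _); apply: addrC.
move/(congr1 (fun B : T => B i j)).
rewrite !trig_coefD !trig_coefN (band_coefMl _ bC' ij) (band_coefMr _ bC' ij).
rewrite (bandMr _ bE') ?(bandMl _ bE') ?jE ?addnS // !p'e -eij subrr.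
case: (e01 i) => ->; rewrite ?mul0r ?mulr0 ?mul1r ?mulr1.
  by rewrite !add0r => /eqP; rewrite oppr_eq0 => /eqP.
by rewrite addrK.
Qed.

(** On the leading superdiagonal of z, the entry is p_ii z_ij q_jj and satisfies A_ii z_ij = z_ij
    A_jj; either way it vanishes, and z moves one band up. *)
Lemma corner_eq0 A p q z :
  A * z = z * A -> z = p * z * q ->
  (forall i j, p i i <> 0 -> q j j <> 0 ->
     forall c : S, A i i * c = c * A j j -> c = 0) ->
  z = 0.
Proof.
move=> Az zE inj; suff /(_ n) : forall d, band d z by apply: band_eq0.
elim=> [|d bz]; first exact: band0.
apply: band_step => // i j jE; have ij : (j <= i + d)%N by rewrite jE.
have := congr1 (fun B : T => B i j) zE.
rewrite (band_coefMr _ (bandMl p bz) ij) (band_coefMl _ bz ij) => zij.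
have [p0|pi0] := pselect (p i i = 0); first by rewrite zij p0 !mul0r.
have [q0|qj0] := pselect (q j j = 0); first by rewrite zij q0 mulr0.
apply: (inj i j) => //; have := congr1 (fun B : T => B i j) Az.
by rewrite (band_coefMr _ bz ij) (band_coefMl _ bz ij).
Qed.

End TriangularRing.

(** * Quasipolarity of triangular matrix rings *)

Section QuasipolarTriangular.
Variables (S : pzRingType) (n : nat) (locS : unit_local S).
Local Notation T := (upper_trig S n).
Implicit Types (A p : T) (i j : 'I_n).

Lemma quasipolar_trig :
  nonunit_unit_surj S -> ((1 < n)%N -> nonunit_unit_inj S) ->
  quasipolar_ring T.
Proof.
move=> sur inj A; pose e i : S := if `[< invertible (A i i) >] then 0 else 1.
have eP i :
    (invertible (A i i) /\ e i = 0) \/ (~ invertible (A i i) /\ e i = 1).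
  by rewrite /e; case: asboolP => ?; [left|right].
have [||p [pp pA pe]] := @exists_commuting_idempotent _ _ A e.
- by move=> i; case: (eP i) => -[_ ->]; [left|right].
- move=> i j; case: (eP i) (eP j) => -[Ui ->] [] [Uj ->] // _ s.
    by have [] := sur _ _ s Uj Ui.
  by have [] := sur _ _ s Ui Uj.
have e1 i : e i <> 0 -> ~ invertible (A i i) by case: (eP i) => -[].
have ee i : e i * e i = e i by case: (eP i) => -[_ ->]; rewrite ?mul0r ?mul1r.
have e0 i : 1 - e i <> 0 -> invertible (A i i).
  by case: (eP i) => -[Ui ->] //; rewrite subrr.
(* A nonunit and a unit diagonal entry occupy two distinct positions, which makes [inj]
   available. *)
have lt1n i j : e i <> 0 -> 1 - e j <> 0 -> (1 < n)%N.
  move=> /e1 nUi /e0 Uj; rewrite ltnNge; apply/negP => n1.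
  suff ij : i = j by rewrite ij in nUi.
  apply: val_inj; have := leq_trans (ltn_ord i) n1.
  have := leq_trans (ltn_ord j) n1.
  by rewrite !ltnS !leqn0 => /eqP j0 /eqP i0; rewrite [LHS]i0 [RHS]j0.
have q_e i : (1 - p) i i = 1 - e i by rewrite !trig_coefE eqxx pe.
exists p; split=> //.
- move=> y yA.
  have qA : (1 - p) * A = A * (1 - p) by rewrite mulrBl mulrBr mul1r mulr1 pA.
  have qq : (1 - p) * (1 - p) = 1 - p.
    by rewrite mulrBl mul1r mulrBr mulr1 pp subrr subr0.
  have zA (u v : T) : u * A = A * u -> v * A = A * v ->
      A * (u * y * v) = u * y * v * A.
    by move=> uA vA; rewrite -!mulrA vA (mulrA y) yA -mulrA !mulrA uA.
  (* Once both corners vanish, p y = p y p = y p. *)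
  have z1 : p * y * (1 - p) = 0.
    apply: (@corner_eq0 _ _ A p (1 - p)); first exact: zA.
      by rewrite !mulrA pp -!mulrA qq.
    move=> i j; rewrite pe q_e => pi qj c.
    by have [] := inj (lt1n _ _ pi qj) _ _ c (e1 _ pi) (e0 _ qj).
  have z2 : (1 - p) * y * p = 0.
    apply: (@corner_eq0 _ _ A (1 - p) p); first exact: zA.
      by rewrite !mulrA qq -!mulrA pp.
    move=> i j; rewrite pe q_e => qi pj c.
    by have [] := inj (lt1n _ _ pj qi) _ _ c (e1 _ pj) (e0 _ qi).
  move: z1 z2; rewrite mulrBr mulr1 !mulrBl mul1r => /eqP; rewrite subr_eq0.
  move=> /eqP pyE /eqP; rewrite subr_eq0 => /eqP ypE.
  by rewrite /GRing.comm pyE ypE.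
- apply/invertible_trigP => i; rewrite trig_coefD pe.
  by case: (eP i) => -[Ui ->]; rewrite ?addr0 // addrC;
    apply: nonunit_invertible1D.
- move=> x _; apply/invertible_trigP => i.
  rewrite trig_coefD trig_coef1 eqxx !trig_coefM_diag pe.
  case: (eP i) => -[Ui ->].
    by rewrite mulr0 mul0r addr0; apply: invertible1.
  by rewrite mulr1; apply: nonunit_invertible1D => //; apply: nonunitMr.
Qed.

Lemma spectral_coef1 A p i :
  p * p = p -> invertible (A + p) -> ~ invertible (A i i) -> p i i = 1.
Proof.
move=> pp /invertible_trigP/(_ i); rewrite trig_coefD => Uap nUa.
have [|p0|//] := unit_local_idem locS (e := p i i).
  by rewrite -trig_coefM_diag pp.
by rewrite p0 addr0 in Uap.
Qed.

Lemma trig_delta_comm (d : 'I_n -> S) i j (ij : (i <= j)%N) (z : S) :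
  d i * z = z * d j -> GRing.comm (trig_delta ij z) (trig_diag d).
Proof.
move=> dz; apply: trig_eqP => k l; rewrite trig_diagMl trig_diagMr trig_deltaE.
by case: eqP => [->|_]; case: eqP => [->|_]; rewrite ?mulr0 ?mul0r ?mulr1n.
Qed.

Lemma comm2_trig_diag (d : 'I_n -> S) p i j (z : S) :
  comm2 (trig_diag d) p -> (i <= j)%N -> d i * z = z * d j ->
  p i i * z = z * p j j.
Proof.
move=> cp ij dz; have := cp _ (trig_delta_comm ij dz).
move/(congr1 (fun B : T => B i j)); rewrite !trig_coefM.
rewrite (bigD1 i) // big1 => [|k ki];
  last by rewrite trig_deltaE (negPf ki) mulr0.
rewrite (bigD1 j) // big1 => [|k kj];
  last by rewrite trig_deltaE (negPf kj) andbF mul0r.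
by rewrite trig_deltaE !eqxx /= !addr0.
Qed.

(** If p_ii were 1, then x = - d_i^-1 E_ii would commute with the quasinilpotent part and give 1 + d
    p x a zero at (i, i). *)
Lemma spectral_diag_coef0 (d : 'I_n -> S) p i :
  p * p = p -> comm2 (trig_diag d) p -> qnil (trig_diag d * p) ->
  invertible (d i) -> p i i = 0.
Proof.
move=> pp cp qn [b [bd db]].
have [|//|p1] := unit_local_idem locS (e := p i i).
  by rewrite -trig_coefM_diag pp.
pose x := trig_delta (leqnn i) (- b).
have xD : GRing.comm x (trig_diag d).
  by apply: trig_delta_comm; rewrite mulrN mulNr bd db.
have /qn/invertible_trigP/(_ i) : GRing.comm x (trig_diag d * p).
  by apply: commrM => //; apply/commr_sym/cp.
rewrite trig_coefD trig_coef1 eqxx !trig_coefM_diag trig_diagE p1 trig_deltaE.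
rewrite !eqxx !mulr1n mulr1 mulrN db subrr => -[c []].
by rewrite mulr0 => c1; case: locS => + _; rewrite -c1.
Qed.

Lemma quasipolar_trig_inj :
  quasipolar_ring T -> (1 < n)%N -> nonunit_unit_inj S.
Proof.
move=> qT n1 a b z nUa Ub.
pose i := Ordinal (ltnW n1); pose j := Ordinal n1.
split=> e.
  (* The spectral idempotent then has p_ii = 1 and p_jj = 0, so p_ii z = z p_jj says z = 0. *)
  pose d (k : 'I_n) := if k == i then a else b.
  have [p [pp cp up qp]] := qT (trig_diag d).
  have := @comm2_trig_diag d p i j z cp isT e.
  rewrite (spectral_coef1 pp up (i := i)) ?trig_diagE ?eqxx //.
  by rewrite (spectral_diag_coef0 pp cp qp (i := j)) // mulr0 mul1r.
pose d (k : 'I_n) := if k == i then b else a.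
have [p [pp cp up qp]] := qT (trig_diag d).
have := @comm2_trig_diag d p i j z cp isT e.
rewrite (spectral_coef1 pp up (i := j)) ?trig_diagE ?eqxx //.
by rewrite (spectral_diag_coef0 pp cp qp (i := i)) // mul0r mulr1.
Qed.

End QuasipolarTriangular.

Lemma quasipolar_trigP (S : pzRingType) (n : nat) :
  unit_local S -> nonunit_unit_surj S ->
  quasipolar_ring (upper_trig S n) <-> ((1 < n)%N -> nonunit_unit_inj S).
Proof.
by move=> locS sur; split; [apply: quasipolar_trig_inj | apply: quasipolar_trig].
Qed.

Theorem corollary4p8 (R : pzRingType) (n : nat)
    (hR : local_ring R) (hB : bleached R) (hn : (0 < n)%N) :
  quasipolar_ring (upper_trig R n) <->
  quasipolar_ring (upper_trig (powerseries R) n).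
Proof.
have locR := local_ring_unit_local hR.
have sur := bleached_nonunit_unit_surj hR hB.
have RP := quasipolar_trigP n locR sur.
have PP := quasipolar_trigP n (ps_unit_local locR) (ps_nonunit_unit_surj sur).
have injP := ps_nonunit_unit_inj R.
by split=> [/RP inj|/PP inj]; [apply/PP => /inj/injP | apply/RP => /inj/injP].
Qed.
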